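(* Let $\mathbb{F}$ be a field and let $A$ be an $n \times n$ matrix over $\mathbb{F}$ all of whose entries lie in $\{0,1,-1\}$. Then every principal submatrix of $A$ has even rank if and only if $A$ is skew-symmetric up to multiplication of rows/columns by $-1$, i.e., there exist diagonal matrices $D,E$ with diagonal entries in $\{1,-1\}$ such that $DAE$ is skew-symmetric.
   Context: An $n\times n$ matrix $M$ over a field is skew-symmetric if $M^T=-M$ and every diagonal entry of $M$ is zero. For $I \subseteq \{1,\ldots,n\}$, the principal submatrix of $A$ induced by $I$ is the matrix obtained from $A$ by deleting the rows and columns indexed by $\{1,\ldots,n\}\setminus I$; the principal submatrices are those induced by all subsets $I$. *)

(* Defs.v *)
From mathcomp Require Import all_boot all_order all_algebra.
Set Implicit Arguments. Unset Strict Implicit. Unset Printing Implicit Defensive.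
Import GRing.Theory.
Local Open Scope ring_scope.

(* Skew-symmetric as in the paper: M^T = -M and every diagonal entry is zero
   (the diagonal condition matters in characteristic 2). *)
Definition skew_symmetric (F : fieldType) (n : nat) (M : 'M[F]_n) : Prop :=
  M^T = - M /\ forall i : 'I_n, M i i = 0.

Definition principal_submx (F : fieldType) (n : nat) (A : 'M[F]_n)
  (I : {set 'I_n}) : 'M[F]_#|I| :=
  mxsub (@enum_val _ (mem I)) (@enum_val _ (mem I)) A.

Definition sign_diag (F : fieldType) (n : nat) (D : 'M[F]_n) : Prop :=
  exists d : 'rV[F]_n, D = diag_mx d /\ forall i, d 0 i \in [:: 1; -1].

(* Main.v *)
Require Import Defs.
From mathcomp Require Import all_boot all_order all_algebra all_fingroup.
From mathcomp Require Import zify ring.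
Set Implicit Arguments. Unset Strict Implicit. Unset Printing Implicit Defensive.
Import GRing.Theory.
Local Open Scope ring_scope.

(** A skew-symmetric matrix has even rank, because the Schur complement of a
    2x2 skew pivot is again skew; sign scalings preserve the rank of principal
    submatrices. Conversely, even principal ranks force a zero diagonal and a
    symmetric support, so [A] lives on a graph whose edge [ij] carries the sign
    [- A i j * A j i], and [A] can be made skew by scaling rows iff this signed
    graph is balanced. Adding vertices one at a time, an obstruction at the new
    vertex [v] is a path avoiding [v] between two neighbours of [v] that require
    opposite signs; a shortest such path closes up through [v] to an induced
    unbalanced cycle. Pivoting on an edge shortens such a cycle by two, and in
    characteristic other than 2 the small cases have odd rank, a contradiction.
    In characteristic 2 symmetry of the support suffices. *)

(** * Ranks by pivoting: skew-symmetric matrices and unbalanced cycles *)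

(** Block elimination: the outer factors [L] and [U] are unitriangular, so the rank is that of the
    block diagonal middle factor. *)
Lemma rank_schur (F : fieldType) (m n : nat) (A Ai : 'M[F]_m) (B : 'M_(m, n))
    (C : 'M_(n, m)) (D : 'M_n) :
  A *m Ai = 1%:M ->
  \rank (block_mx A B C D) = (m + \rank (D - C *m Ai *m B)%R)%N.
Proof.
move=> AAi; have AiA := mulmx1C AAi.
have uA : A \in unitmx by case: (mulmx1_unit AAi).
pose L : 'M[F]_(m + n) := block_mx 1%:M 0 (C *m Ai) 1%:M.
pose U : 'M[F]_(m + n) := block_mx 1%:M (Ai *m B) 0 1%:M.
have -> : block_mx A B C D = L *m block_mx A 0 0 (D - C *m Ai *m B) *m U.
  rewrite /L /U !mulmx_block !mul1mx !mulmx1 !mul0mx !mulmx0 !addr0 !add0r.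
  rewrite mulmxA AAi mul1mx -(mulmxA C) AiA mulmx1 !mulmxA.
  by rewrite addrC subrK.
have fL : row_free L^T.
  by rewrite row_free_unit unitmx_tr unitmxE det_lblock !det1 mulr1 unitr1.
have fU : row_free U by rewrite row_free_unit unitmxE det_ublock !det1 mulr1 unitr1.
rewrite (mxrankMfree _ fU) -mxrank_tr trmx_mul (mxrankMfree _ fL) mxrank_tr.
by rewrite rank_diag_block_mx (mxrank_unit uA).
Qed.

(** Only the pivot block has to be skew; the rest of [M] is arbitrary, so the formula also serves
    cycle matrices, which contain a symmetric pair. [K] is the inverse of the pivot block. *)
Lemma rank_pivot2 (F : fieldType) (n : nat) (M : 'M[F]_(2 + n)) (p : F) :
  let o0 := lshift n (0 : 'I_2) in let o1 := lshift n (1 : 'I_2) in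
  p != 0 -> M o0 o0 = 0 -> M o1 o1 = 0 -> M o0 o1 = p -> M o1 o0 = - p ->
  \rank M = (\rank (\matrix_(i < n, j < n)
     (M (rshift 2 i) (rshift 2 j) +
      (M (rshift 2 i) o0 * M o1 (rshift 2 j)
       - M (rshift 2 i) o1 * M o0 (rshift 2 j)) / p)%R)).+2.
Proof.
move=> o0 o1 p0 M00 M11 M01 M10.
pose K : 'M[F]_2 := \matrix_(i, j)
  (p^-1 *+ ((i == 1) && (j == 0)) - p^-1 *+ ((i == 0) && (j == 1))).
rewrite -{1}[M]submxK (@rank_schur _ _ _ _ K).
  rewrite add2n; congr (_ .+2); congr (\rank _); apply/matrixP=> i j.
  rewrite !mxE !big_ord_recl big_ord0 !mxE !big_ord_recl !big_ord0 !mxE /=.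
  rewrite -/o0 -/o1 (_ : lshift n (lift _ _) = o1); last exact/val_inj.
  by rewrite /=; field.
apply/matrixP=> i j; rewrite !mxE !big_ord_recl big_ord0 !mxE /=.
have l1 : lift ord0 ord0 = 1 :> 'I_2 by apply/val_inj.
by case: (unliftP 0 i) => [i'|] ->; case: (unliftP 0 j) => [j'|] ->;
  rewrite ?(ord1 i') ?(ord1 j') ?l1 -/o0 -/o1 ?M00 ?M01 ?M10 ?M11 /=; field.
Qed.

(** The hypotheses force [m = n], so [f] and [g] merely permute rows and columns; two names for the
    dimension avoid a cast. *)
Lemma rank_mxsub_inj (F : fieldType) (m n : nat) (f g : 'I_m -> 'I_n)
    (M : 'M[F]_n) :
  (n <= m)%N -> injective f -> injective g -> \rank (mxsub f g M) = \rank M.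
Proof.
move=> le_nm inj_f inj_g.
have rank_rowsub k h (N : 'M[F]_(n, k)) :
  injective h -> \rank (rowsub (h : 'I_m -> 'I_n) N) = \rank N.
  move=> inj_h; have [] := eqmx_rowsub_comp id N le_nm inj_h.
  by move=> -> _; congr (\rank _); apply/matrixP=> i j; rewrite mxE.
have -> : mxsub f g M = rowsub f (rowsub g M^T)^T by apply/matrixP=> i j; rewrite !mxE.
by rewrite rank_rowsub // mxrank_tr rank_rowsub // mxrank_tr.
Qed.

Lemma skew_symmetric_entry (F : fieldType) (n : nat) (M : 'M[F]_n) (i j : 'I_n) :
  skew_symmetric M -> M j i = - M i j.
Proof. by case=> /matrixP/(_ i j); rewrite !mxE. Qed.

Lemma skew_symmetric_rank_even (F : fieldType) (n : nat) (M : 'M[F]_n) :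
  skew_symmetric M -> ~~ odd (\rank M).
Proof.
have [m] := ubnP n; elim: m n M => // m IHm n M le_nm sM.
have [->|/matrix0Pn[i [j Mij]]] := eqVneq M 0; first by rewrite mxrank0.
have nij : j != i by apply: contra_neq Mij => ->; case: sM.
case: n => [|[|n]] in M i j le_nm sM Mij nij *; first by have := ltn_ord i.
  by rewrite !ord1 in nij.
pose o0 : 'I_n.+2 := lshift n (0 : 'I_2); pose o1 : 'I_n.+2 := lshift n (1 : 'I_2).
(* The first swap sends [o1] to the preimage of [j] under [tperm o0 i], and fixes [o0] because
   [j != i]. *)
pose s : 'S_n.+2 := (tperm o1 (tperm o0 i j) * tperm o0 i)%g.
have s1 : s o1 = j by rewrite permM tpermL tpermK.
have s0 : s o0 = i.
  rewrite permM [tperm o1 _ _]tpermD ?tpermL //.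
  by rewrite -{2}(tpermR o0 i) (inj_eq perm_inj).
rewrite -(rank_mxsub_inj M (leqnn _) (@perm_inj _ s) (@perm_inj _ s)).
rewrite (@rank_pivot2 _ n _ (M i j)) //; rewrite ?mxE ?s0 ?s1 //.
- rewrite /= negbK; apply: IHm; first by lia.
  split=> [|k]; last first.
    rewrite !mxE -/o0 -/o1 s0 s1.
    rewrite (skew_symmetric_entry i _ sM) (skew_symmetric_entry j _ sM).
    by case: (sM) => _ ->; field.
  apply/matrixP=> k l; rewrite !mxE -/o0 -/o1 s0 s1.
  rewrite (skew_symmetric_entry (s (rshift 2 k)) _ sM).
  rewrite !(skew_symmetric_entry i (s _) sM) !(skew_symmetric_entry j (s _) sM).
  by field.
- by case: sM.
- by case: sM.
- by rewrite (skew_symmetric_entry i _ sM).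
Qed.

(* The path [0, ..., m] carries skew entries [p i], and the closing vertex [m.+1]
   is joined to [0] by a skew pair ([a], [- a]) and to [m] by a symmetric pair
   ([b], [b]). For [m = 0] the two edges are parallel and their entries add. *)
Definition cycle_entry (F : fieldType) (m : nat) (p : nat -> F) (a b : F)
    (i j : nat) : F :=
  if i == m.+1 then
    if j == m.+1 then 0 else b *+ (j == m) - a *+ (j == 0%N)
  else if j == m.+1 then b *+ (i == m) + a *+ (i == 0%N)
  else p i *+ (j == i.+1) - p j *+ (i == j.+1).

(** Pivoting on the edge from 0 to 1 deletes both vertices and joins the closing vertex to 2 by a
    skew pair of weight [p 1 * a / p 0], so [m] drops by two. For [m = 0] the entries are [b + a]
    and [b - a], exactly one of which vanishes; for [m = 1] the pivot leaves one nonzero entry,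
    giving rank 3. *)
Lemma cycle_rank_odd (F : fieldType) (m : nat) (p : nat -> F) (a b : F) :
  (2%:R : F) != 0 -> (forall i, (i < m)%N -> p i ^+ 2 = 1) ->
  a ^+ 2 = 1 -> b ^+ 2 = 1 ->
  odd (\rank (\matrix_(i < m.+2, j < m.+2) cycle_entry m p a b i j)).
Proof.
move=> nz2; have sq_neq0 (x : F) : x ^+ 2 = 1 -> x != 0.
  by apply: contra_eq_neq => ->; rewrite expr0n eq_sym oner_eq0.
have [k] := ubnP m; elim: k m p a => // k IHk [|[|m]] p a le_mk hp a1 b1.
- have b0 := sq_neq0 _ b1.
  have [ab|nab] := eqVneq a b.
    have -> : (\matrix_(i < 2, j < 2) cycle_entry 0 p a b i j)
       = (b *+ 2) *: delta_mx 0 1.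
      apply/matrixP=> i j; rewrite !mxE /cycle_entry ab.
      case: i => [[|[|i]]] Hi //; case: j => [[|[|j]]] Hj //=;
      by rewrite ?eqxx /=; ring.
    by rewrite mxrank_scale_nz ?mxrank_delta // -mulr_natr mulf_neq0.
  have {}nab : a = - b.
    by have/eqP := a1; rewrite -b1 eqf_sqr (negPf nab) => /eqP.
  have -> : (\matrix_(i < 2, j < 2) cycle_entry 0 p a b i j)
       = (b *+ 2) *: delta_mx 1 0.
    apply/matrixP=> i j; rewrite !mxE /cycle_entry nab.
    case: i => [[|[|i]]] Hi //; case: j => [[|[|j]]] Hj //=;
      by rewrite ?eqxx /=; ring.
  by rewrite mxrank_scale_nz ?mxrank_delta // -mulr_natr mulf_neq0.
- have p0 := sq_neq0 _ (hp 0%N isT).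
  rewrite (@rank_pivot2 _ 1 _ (p 0%N)) //; rewrite ?mxE /cycle_entry /=; try ring.
  set x := (X in \rank X).
  have -> : x = ((- 2%:R * a * b / p 0%N)%:M).
    by apply/matrixP=> i j; rewrite !ord1 !mxE /= ?eqxx /=; field.
  rewrite rank_rV /= negbK -scalemx1 scaler_eq0 oner_eq0 orbF.
  by rewrite !mulf_neq0 ?oppr_eq0 ?invr_neq0 // sq_neq0.
have p0 := sq_neq0 _ (hp 0%N isT).
rewrite (@rank_pivot2 _ m.+2 _ (p 0%N)) //; rewrite ?mxE /cycle_entry /=; try ring.
rewrite negbK; set x := (X in \rank X).
pose a' := p 1%N * a / p 0%N.
have -> : x = \matrix_(i < m.+2, j < m.+2) cycle_entry m (fun i => p i.+2) a' b i j.
  apply/matrixP=> -[i Hi] [j Hj]; rewrite !mxE /cycle_entry /a' /= !add2n !eqSS.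
  rewrite !(modn_small (isT : 1 < 2)%N).
  case: (eqVneq i m.+1) => [ei|ni]; case: (eqVneq j m.+1) => [ej|nj] //=.
  - by field.
  - by case: j {Hj nj} => [|j] /=; field.
  - by case: i {Hi ni} => [|i] /=; field.
  - by case: i {Hi ni} => [|i]; case: j {Hj nj} => [|j] /=; field.
apply: IHk => // [|i lt_im|]; [by lia|by apply: hp; lia|].
by rewrite !exprMn hp // exprVn hp // a1 invr1 !mulr1.
Qed.

(** * Shortest walks between two sets of vertices *)

(** The walk has least length among all walks from [P] to [Q], with both ends free. A chord, a
    repetition, a later vertex in [P] or an earlier one in [Q] would give a shorter walk. *)
Lemma shortest_walk (T : finType) (e : rel T) (P Q : pred T) (x y : T) :
  P x -> Q y -> connect e x y ->
  exists (m : nat) (w : nat -> T),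
    [/\ P (w 0%N) /\ Q (w m),
        forall i, (i < m)%N -> e (w i) (w i.+1),
        forall i j, (i < j <= m)%N -> e (w i) (w j) -> j = i.+1,
        forall i j, (i < j <= m)%N -> w i != w j
      & (forall i, (0 < i <= m)%N -> ~~ P (w i)) /\
        (forall i, (i < m)%N -> ~~ Q (w i))].
Proof.
move=> Px Qy exy.
pose walk m w := [/\ P (w 0%N), Q (w m) & forall i, (i < m)%N -> e (w i) (w i.+1)].
(* Finite functions make the existence of a walk of length [m] decidable, so that a least [m] can be
   chosen. *)
pose walkb m := [exists t : {ffun 'I_m.+1 -> T},
  [&& P (t (inord 0)), Q (t (inord m))
    & [forall i : 'I_m, e (t (inord i)) (t (inord i.+1))]]].
have walkbP m : reflect (exists w, walk m w) (walkb m).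
  apply: (iffP existsP) => [[t /and3P[Pt Qt /forallP et]]|[w [Pw Qw ew]]].
    by exists (fun i => t (inord i)); split=> // i lt_im; apply: (et (Ordinal lt_im)).
  exists [ffun i : 'I_m.+1 => w i]; rewrite !ffunE !inordK // Pw Qw /=.
  by apply/forallP=> i; rewrite !ffunE !inordK ?ew // ltnS // ltnW.
have ex_walk : exists m, walkb m.
  have /connectP[p ep y_last] := exy.
  exists (size p); apply/walkbP; exists (nth x (x :: p)).
  split=> //; first by rewrite -(last_nth x x p) -y_last.
  by move=> i lt_ip; have /(pathP x)/(_ i lt_ip) := ep.
case: (ex_minnP ex_walk) => m /walkbP[w [Pw Qw ew]] min_m.
have {walkb walkbP ex_walk}min_m m' w' : walk m' w' -> (m <= m')%N.
  by move=> Ww'; apply: min_m; apply/walkbP; exists w'.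
exists m, w; split=> // [i j lt_ijm eij|i j lt_ijm|].
- apply/eqP; rewrite eqn_leq; apply/andP; split; last by lia.
  suff : (m <= m - (j - i.+1))%N by lia.
  (* Jump along the chord from [w i] to [w j]. *)
  apply: (min_m _ (fun t => if (t <= i)%N then w t else w (t + (j - i.+1))%N)).
  split=> [//||t lt_t].
    by rewrite ifN; [rewrite subnK //|]; lia.
  case: (ltngtP t i) => [lt_ti|lt_it|->].
  + by rewrite ew //; lia.
  + by rewrite addSn ew //; lia.
  + by rewrite (_ : (i.+1 + (j - i.+1) = j)%N) //; lia.
- apply/eqP=> wij.
  suff : (m <= m - (j - i))%N by lia.
  (* Cut out the loop between the two equal vertices. *)
  apply: (min_m _ (fun t => if (t < i)%N then w t else w (t + (j - i))%N)).
  split=> [||t lt_t].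
  + by case: (posnP i) => [i0|//]; rewrite add0n i0 subn0 -wij i0.
  + by rewrite ifN; [rewrite subnK //|]; lia.
  + case: (ltngtP t.+1 i) => [lt_ti|lt_it|eq_ti].
    * by apply: ew; lia.
    * by rewrite addSn ew //; lia.
    * rewrite eq_ti (_ : (i + (j - i) = j)%N); last by lia.
      by rewrite -wij -eq_ti ew //; lia.
- split=> i lt_im; apply/negP=> Hi.
    suff : (m <= m - i)%N by lia.
    apply: (min_m _ (fun t => w (t + i)%N)); split=> [//||t lt_t].
      by rewrite subnK //; lia.
    by rewrite addSn ew //; lia.
  suff : (m <= i)%N by lia.
  by apply: (min_m _ w); split=> // t lt_t; apply: ew; lia.
Qed.

(** * Principal submatrices and sign scalings *)

(** Injections, unlike sets, allow a cycle to be listed in cyclic order. [f] differs from the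
    enumeration of its image by a permutation, which preserves the rank. *)
Lemma rank_mxsub_even (F : fieldType) (n : nat) (A : 'M[F]_n) :
  (forall I : {set 'I_n}, ~~ odd (\rank (principal_submx A I))) ->
  forall (k : nat) (f : 'I_k -> 'I_n), injective f ->
  ~~ odd (\rank (mxsub f f A)).
Proof.
move=> evenA k f inj_f; pose I := [set f i | i in [set: 'I_k]].
pose g i := enum_rank_in (imset_f f (in_setT i) : f i \in I) (f i).
have gK i : enum_val (g i) = f i by rewrite enum_rankK_in // imset_f.
have inj_g : injective g by move=> i j /(congr1 enum_val); rewrite !gK => /inj_f.
have -> : mxsub f f A = mxsub g g (principal_submx A I).
  by apply/matrixP=> i j; rewrite !mxE !gK.
by rewrite rank_mxsub_inj // card_imset // cardsT card_ord.
Qed.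

Lemma rank_diag_mull (F : fieldType) (n : nat) (d : 'rV[F]_n) (M : 'M_n) :
  (forall i, d 0 i ^+ 2 = 1) -> \rank (diag_mx d *m M) = \rank M.
Proof.
move=> d1; have dd : diag_mx d *m diag_mx d = 1%:M.
  apply/matrixP=> i j; by rewrite mul_diag_mx !mxE mulrnAr -expr2 d1.
apply/eqP; rewrite eqn_leq mxrankM_maxr -{1}[M]mul1mx -dd -mulmxA.
exact: mxrankM_maxr.
Qed.

(** * Row signs obtained from even principal ranks *)

Section EvenPrincipalRanks.

Variables (F : fieldType) (n : nat) (A : 'M[F]_n).
Hypothesis entA : forall i j, A i j \in [:: 0; 1; -1].
Hypothesis evenA : forall (k : nat) (f : 'I_k -> 'I_n), injective f ->
  ~~ odd (\rank (mxsub f f A)).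

Lemma diag_eq0 i : A i i = 0.
Proof.
have := evenA (f := fun _ : 'I_1 => i) (fun x y _ => etrans (ord1 x) (esym (ord1 y))).
have -> : mxsub (fun _ : 'I_1 => i) (fun _ : 'I_1 => i) A = (A i i)%:M.
  by apply/matrixP=> x y; rewrite !ord1 !mxE eqxx.
rewrite rank_rV -scalemx1 scaler_eq0 oner_eq0 orbF.
by case: eqP.
Qed.

(** Otherwise the principal submatrix on [i] and [j] would have a single nonzero entry, hence rank
    one. *)
Lemma entry_eq0_sym i j : A i j = 0 -> A j i = 0.
Proof.
move=> Aij; have [<-|nij] := eqVneq i j; first exact: diag_eq0.
pose f (x : 'I_2) := if x == 0 then i else j.
have inj_f : injective f.
  move=> x y; rewrite /f; case: (unliftP 0 x) => [x'|] ->;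
  case: (unliftP 0 y) => [y'|] ->; rewrite ?(ord1 x') ?(ord1 y') //= => eij;
  by rewrite eij eqxx in nij.
have := evenA inj_f.
have -> : mxsub f f A = A j i *: delta_mx 1 0.
  apply/matrixP=> x y; rewrite !mxE /f.
  case: (unliftP 0 x) => [x'|] ->; case: (unliftP 0 y) => [y'|] ->;
  by rewrite ?(ord1 x') ?(ord1 y') /= ?diag_eq0 ?Aij ?mulr0 ?mulr1.
by case: (eqVneq (A j i) 0) => // nz; rewrite mxrank_scale_nz ?mxrank_delta.
Qed.

Lemma entry_sqr i j : A i j != 0 -> A i j ^+ 2 = 1.
Proof.
have := entA i j; rewrite !inE => /or3P[] /eqP -> //.
- by rewrite eqxx.
- by rewrite expr1n.
- by rewrite sqrrN expr1n.
Qed.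

(** Partial solution for the induction over vertices. Row signs are enough: if [D A E] is skew, so
    is its conjugate [E D A], as [E] squares to the identity. *)
Definition skew_signing (k : nat) (c : 'I_n -> F) : Prop :=
  (forall i, c i ^+ 2 = 1) /\
  forall i j : 'I_n, (i < k)%N -> (j < k)%N -> c i * A i j = - (c j * A j i).

(** The sign of [x] fits sign 1 at [v], that of [y] does not. A shortest path between two such
    vertices closes through [v] to an induced cycle, whose row-scaled matrix is given by
    [cycle_entry] and has odd rank. *)
Lemma no_unbalanced_cycle (k : nat) (v : 'I_n) (c : 'I_n -> F) (x y : 'I_n) :
  (2%:R : F) != 0 -> v = k :> nat -> skew_signing k c ->
  (x < k)%N -> A x v != 0 -> c x * A x v = - A v x ->
  (y < k)%N -> A y v != 0 -> c y * A y v = A v y ->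
  ~~ connect [rel i j : 'I_n | [&& (i < k)%N, (j < k)%N & A i j != 0]] x y.
Proof.
move=> nz2 vk [c1 skewc] ltx Axv cx lty Ayv cy; apply/negP.
pose good (i : 'I_n) := [&& (i < k)%N, A i v != 0 & c i * A i v == - A v i].
pose bad (i : 'I_n) := [&& (i < k)%N, A i v != 0 & c i * A i v == A v i].
have goodx : good x by rewrite /good ltx Axv cx /=.
have bady : bad y by rewrite /bad lty Ayv cy /=.
move=> /(shortest_walk goodx bady)[m [w [[]]]].
move=> good0 badm ew chordless inj_w [ngood nbad].
have ltw i : (i <= m)%N -> (w i < k)%N.
  by case: i => [_|i /ew /and3P[] //]; case/and3P: good0.
have neighbour (i : 'I_n) : (i < k)%N -> A i v != 0 -> good i || bad i.
  move=> lt_ik nz; rewrite /good /bad lt_ik nz /= orbC -eqf_sqr.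
  rewrite exprMn c1 mul1r !entry_sqr //.
  by apply: contra_neq nz; apply: entry_eq0_sym.
(* A path of length zero would be a vertex both good and bad, impossible when 2 is nonzero. *)
have m_gt0 : (0 < m)%N.
  case: (posnP m) badm => // -> /and3P[_ nz /eqP badm].
  case/and3P: good0 => _ _ /eqP; rewrite badm => /eqP.
  rewrite -addr_eq0 -mulr2n -mulr_natl mulf_eq0 (negPf nz2) /= => /eqP.
  by move/entry_eq0_sym => /eqP; rewrite (negPf nz).
(* Every neighbour of [v] below [k] is good or bad, and minimality keeps both kinds out of the
   interior. *)
have interior i : (0 < i < m)%N -> A (w i) v = 0.
  case/andP=> i_gt0 lt_im; apply/eqP/negPn/negP=> /(neighbour _ (ltw i (ltnW lt_im))).
  by rewrite (negPf (ngood i _)) ?(negPf (nbad i _)) // i_gt0 ltnW.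
have path_entry i j : (i <= m)%N -> (j <= m)%N -> j != i.+1 -> i != j.+1 ->
    A (w i) (w j) = 0.
  move=> lei lej nji nij.
  have chord i' j' : (i' < j' <= m)%N -> j' != i'.+1 -> A (w i') (w j') = 0.
    move=> Hij; apply: contra_neq_eq => nz; apply: chordless => //=.
    by rewrite nz !ltw //; lia.
  case: (ltngtP i j) => [lt_ij|lt_ji|->]; last exact: diag_eq0.
    by apply: chord; lia.
  by apply: entry_eq0_sym; apply: chord; lia.
pose f (i : 'I_m.+2) := if i == m.+1 :> nat then v else w i.
have inj_f : injective f.
  have neq (i j : 'I_m.+2) : (i < j)%N -> f i != f j.
    move=> lt_ij; have lti : (i <= m)%N by have := ltn_ord j; lia.
    rewrite /f (ltn_eqF (lti : i < m.+1)%N); case: (eqVneq (j : nat) m.+1) => [_|nj].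
      by rewrite -val_eqE /= vk; have := ltw _ lti; lia.
    by apply: inj_w; have := ltn_ord j; lia.
  move=> i j fij; apply/val_inj/eqP => /=.
  by case: ltngtP => // /neq; rewrite fij eqxx.
have := evenA inj_f; apply/negP; rewrite negbK.
(* After this scaling the path edges and the edge from [v] to [w 0] are skew, while the edge from
   [v] to [w m] is symmetric. *)
pose d := \row_(i < m.+2) (if i == m.+1 :> nat then 1 else c (w i)).
rewrite -(@rank_diag_mull _ _ d); last first.
  by move=> i; rewrite mxE; case: ifP => _ //; rewrite expr1n.
have wnz i : (i < m)%N -> A (w i) (w i.+1) != 0 by case/ew/and3P.
have [_ nz0 /eqP eq0] := and3P good0; have [_ nzm /eqP eqm] := and3P badm.
have -> : diag_mx d *m mxsub f f A = \matrix_(i < m.+2, j < m.+2)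
    cycle_entry m (fun i => c (w i) * A (w i) (w i.+1))
      (c (w 0%N) * A (w 0%N) v) (c (w m) * A (w m) v) i j.
  apply/matrixP=> -[i Hi] [j Hj]; rewrite mul_diag_mx !mxE /f /cycle_entry /=.
  case: (eqVneq i m.+1) => [ei|ni]; case: (eqVneq j m.+1) => [ej|nj] //=.
  - by rewrite diag_eq0 mulr0.
  - rewrite mul1r; case: (eqVneq j m) => [->|njm].
      by rewrite (gtn_eqF m_gt0) mulr0n subr0 eqm.
    case: (posnP j) => [->|j_gt0]; first by rewrite sub0r eq0 opprK.
    by rewrite subr0; apply: entry_eq0_sym; apply: interior; lia.
  - case: (eqVneq i m) => [->|nim].
      by rewrite (gtn_eqF m_gt0) mulr0n addr0.
    case: (posnP i) => [->|i_gt0]; first by rewrite add0r.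
    by rewrite addr0 interior ?mulr0 //; lia.
  - case: (eqVneq j i.+1) => [->|nji].
      by rewrite (ltn_eqF (_ : i < i.+2)%N) ?mulr0n ?subr0 //; lia.
    case: (eqVneq i j.+1) => [ij|nij].
      by rewrite ij sub0r skewc //; apply: ltw; lia.
    by rewrite subr0 path_entry ?mulr0 //; lia.
by apply: cycle_rank_odd => // [i lt_im||];
  rewrite exprMn c1 mul1r entry_sqr // wnz.
Qed.

(** The new vertex gets sign 1, and every component of the old graph containing a bad neighbour is
    flipped as a whole, which keeps the old block skew. *)
Lemma skew_signing_extend (k : nat) (c : 'I_n -> F) :
  (2%:R : F) != 0 -> (k < n)%N -> skew_signing k c ->
  exists c', skew_signing k.+1 c'.
Proof.
move=> nz2 lt_kn sc; have [c1 skewc] := sc; pose v := Ordinal lt_kn.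
pose e := [rel i j : 'I_n | [&& (i < k)%N, (j < k)%N & A i j != 0]].
pose bad (i : 'I_n) := [&& (i < k)%N, A i v != 0 & c i * A i v == A v i].
pose flip i := [exists j, bad j && connect e i j].
have esym : connect_sym e.
  apply: sym_connect_sym => i j /=; rewrite andbCA; congr [&& _, _ & ~~ _].
  by apply/eqP/eqP; apply: entry_eq0_sym.
have flip_edge (i j : 'I_n) : (i < k)%N -> (j < k)%N -> A i j != 0 -> flip i = flip j.
  move=> lti ltj nz; apply: eq_existsb => l; congr (_ && _).
  by apply: (same_connect esym); apply: connect1; rewrite /e /= lti ltj.
pose c' i := if i == v then 1 else if flip i then - c i else c i.
have c'v (i : 'I_n) : (i < k)%N -> c' i * A i v = - A v i.
  move=> lti; rewrite /c' -val_eqE /= (ltn_eqF lti).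
  have [z|nz] := eqVneq (A i v) 0; first by rewrite z (entry_eq0_sym z) oppr0 mulr0.
  have : c i * A i v == A v i \/ c i * A i v == - A v i.
    apply/orP; rewrite -eqf_sqr exprMn c1 mul1r !entry_sqr //.
    by apply: contra_neq nz; apply: entry_eq0_sym.
  case=> Hi.
    have -> : flip i by apply/existsP; exists i; rewrite /bad lti nz Hi connect0.
    by rewrite mulNr (eqP Hi).
  (* A flipped good neighbour would be connected to a bad one. *)
  rewrite ifN ?(eqP Hi) //; apply/existsP=> -[j /andP[/and3P[ltj nzj /eqP badj]]].
  by apply/negP; apply: (no_unbalanced_cycle nz2 _ sc lti nz (eqP Hi) ltj).
exists c'; split=> [i|i j].
  by rewrite /c'; case: ifP => _; [rewrite expr1n|case: ifP => _; rewrite ?sqrrN].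
have c'vv : c' v = 1 by rewrite /c' eqxx.
rewrite ltnS leq_eqVlt => /orP[/eqP ik|lti];
  rewrite ltnS leq_eqVlt => /orP[/eqP jk|ltj].
- have [-> ->] : i = v /\ j = v by split; apply/val_inj.
  by rewrite diag_eq0 mulr0 oppr0.
- have -> : i = v by apply/val_inj.
  by rewrite c'v // c'vv mul1r opprK.
- have -> : j = v by apply/val_inj.
  by rewrite c'v // c'vv mul1r.
- have [z|nz] := eqVneq (A i j) 0; first by rewrite z (entry_eq0_sym z) !mulr0 oppr0.
  rewrite /c' -!val_eqE /= (ltn_eqF lti) (ltn_eqF ltj) (flip_edge i j) //.
  by case: ifP => _; rewrite ?mulNr skewc.
Qed.

Lemma exists_skew_signing : exists c, skew_signing n c.
Proof.
have [z2|nz2] := eqVneq (2%:R : F) 0.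
  exists (fun=> 1); split=> [i|i j _ _]; rewrite ?expr1n // !mul1r.
  have oppK (x : F) : - x = x.
    by apply/eqP; rewrite eq_sym -addr_eq0 -mulr2n -mulr_natl z2 mul0r.
  have [z|nz] := eqVneq (A i j) 0; first by rewrite z (entry_eq0_sym z) oppr0.
  have nz' : A j i != 0 by apply: contra_neq nz; apply: entry_eq0_sym.
  (* Since [-1 = 1], both nonzero entries are 1. *)
  have := entA i j; have := entA j i; rewrite !inE (negPf nz) (negPf nz').
  by rewrite !oppK !orbb /= => /eqP-> /eqP->.
suff: forall k, (k <= n)%N -> exists c, skew_signing k c by apply.
elim=> [_|k IHk lt_kn]; first by exists (fun=> 1); split=> // i; rewrite expr1n.
by have [c] := IHk (ltnW lt_kn); apply: skew_signing_extend.
Qed.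

End EvenPrincipalRanks.

(** * The equivalence *)

Lemma sign_mem_sqr (F : fieldType) (x : F) : (x \in [:: 1; -1]) = (x ^+ 2 == 1).
Proof. by rewrite !inE sqrf_eq1. Qed.

Theorem mainTheorem2 (F : fieldType) (n : nat) (A : 'M[F]_n)
  (hA : forall i j, A i j \in [:: 0; 1; -1]) :
  (forall I : {set 'I_n}, ~~ odd (\rank (principal_submx A I)))
  <-> (exists D E : 'M[F]_n,
         sign_diag D /\ sign_diag E /\ skew_symmetric (D *m A *m E)).
Proof.
split=> [evenA|[_ [_ [[d [-> d1]] [[e [-> e1]] skewDAE]]]] I].
  have [c [c1 skewc]] := exists_skew_signing hA (rank_mxsub_even evenA).
  exists (diag_mx (\row_i c i)), 1%:M; split; last split.
  - by exists (\row_i c i); split=> // i; rewrite mxE sign_mem_sqr c1.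
  - exists (const_mx 1); rewrite diag_const_mx; split=> // i.
    by rewrite mxE mem_head.
  - rewrite mulmx1 mul_diag_mx; split=> [|i]; last first.
      by rewrite !mxE (diag_eq0 (rank_mxsub_even evenA)) mulr0.
    by apply/matrixP=> i j; rewrite !mxE skewc.
pose f := @enum_val _ (mem I).
pose d' := \row_i d 0 (f i); pose e' := \row_i e 0 (f i).
(* Column scaling is written as row scaling of the transpose, so that [rank_diag_mull] handles both
   sides. *)
have rE : \rank (diag_mx d' *m (diag_mx e' *m (principal_submx A I)^T)^T)
    = \rank (principal_submx A I).
  rewrite rank_diag_mull => [|i]; last by apply/eqP; rewrite -sign_mem_sqr mxE.
  rewrite mxrank_tr rank_diag_mull ?mxrank_tr // => i.
  by apply/eqP; rewrite -sign_mem_sqr mxE.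
rewrite -rE; apply: skew_symmetric_rank_even.
have entE i j : (diag_mx d' *m (diag_mx e' *m (principal_submx A I)^T)^T) i j
    = (diag_mx d *m A *m diag_mx e) (f i) (f j).
  by rewrite !mul_diag_mx mul_mx_diag !mxE mulrA mulrAC.
split=> [|i]; last by rewrite entE; case: skewDAE.
by apply/matrixP=> i j; rewrite mxE [RHS]mxE !entE (skew_symmetric_entry (f i) (f j)).
Qed.
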